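(* Let $A$ be a bounded normal operator in $\mathcal H$, let $x\in\mathcal H$, and let $C>0$. Then the following statements are equivalent. (i) The sequence $(A^kx)_{k\in\mathbb N}$ is a Bessel sequence in $\mathcal H$ with Bessel bound $C$. (ii) The sequence $((A^* )^kx)_{k\in\mathbb N}$ is a Bessel sequence in $\mathcal H$ with Bessel bound $C$. (iii) The sequence $(e_k)_{k\in\mathbb N}$ of monomials $e_k(z)=z^k$ is a Bessel sequence in $L^2(\mu_x)$ with Bessel bound $C$.
   Context: $\mathcal H$ is a complex Hilbert space with scalar product $\langle\cdot,\cdot\rangle$. $\mathbb N$ includes zero. A sequence $(y_k)_{k\in\mathbb N}$ in a Hilbert space is a Bessel sequence with Bessel bound $C>0$ if $\sum_{k\in\mathbb N}|\langle y,y_k\rangle|^2\le C\|y\|^2$ for all $y$ in that space. $E$ denotes the spectral measure of $A$ (on the Borel sets of $\mathbb C$) and $\mu_x$ is the finite positive Borel measure on $\mathbb C$ given by $\mu_x(\Delta)=\langle E(\Delta)x,x\rangle=\|E(\Delta)x\|^2$. *)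

(* Defs.v *)
From HB Require Import structures.
From mathcomp Require Import all_boot all_order all_algebra.
From mathcomp Require Import sesquilinear.
From mathcomp Require Import complex.
From mathcomp Require Import all_classical all_reals all_analysis.

Set Implicit Arguments.
Unset Strict Implicit.
Unset Printing Implicit Defensive.

Import Order.TTheory GRing.Theory Num.Theory.
Import numFieldNormedType.Exports.
Import ComplexField.Normc.

Local Open Scope classical_set_scope.
Local Open Scope ring_scope.
Local Open Scope complex_scope.

(* Both all_algebra and complex export a Re and an Im; the ones below are the
   R-valued projections of R[i]. *)
Notation ReC := complex.Re.
Notation ImC := complex.Im.

(* The scalar product is linear in its first argument and conjugate-linear in
   its second one. *)
HB.mixin Record CompleteNormedModule_isHilbert (R : realType) (H : Type)
    of CompleteNormedModule R[i] H := {
  hdot : {dot H for (@Num.conj R[i])};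
  hdot_norm : forall y : H, `|y| ^+ 2 = hdot y y
}.

#[short(type="hilbertType")]
HB.structure Definition Hilbert (R : realType) :=
  {H of CompleteNormedModule R[i] H & CompleteNormedModule_isHilbert R H}.

Notation "''[' u , v ]" := (hdot u v)
  (at level 0, format "''[' u ,  v ]") : ring_scope.

Section operators.
Context {R : realType} {H : hilbertType R}.
Implicit Types A B P : {linear H -> H}.

Definition is_bounded_operator A := bounded_near A (nbhs (0 : H)).

Definition is_adjoint A B := forall y z : H, '[A y, z] = '[y, B z].

Definition is_orthogonal_projection P :=
  (forall y, P (P y) = P y) /\ is_adjoint P P.

End operators.

(* S is the carrier of a space with scalar product ip; S and ip are explicit so
   that the same notion applies to a Hilbert space and to L2. *)
Definition is_bessel_sequence {R : realType} {V : Type} (S : set V)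
    (ip : V -> V -> R[i]) (y : nat -> V) (C : R) :=
  (forall k, S (y k)) /\
  forall v, S v ->
    (\sum_(0 <= k <oo) ((normc (ip v (y k))) ^+ 2)%:E <=
     (C * ReC (ip v v))%:E)%E.

Definition bessel_in (R : realType) (H : hilbertType R) (y : nat -> H) (C : R) :=
  is_bessel_sequence [set: H] (fun u v => '[u, v]) y C.

Definition complexBorel (R : realType) := 
  g_sigma_algebraType (@open (R[i] : numFieldType)).

Section complex_integral.
Context {R : realType}.
Variable mu : {measure set (complexBorel R) -> \bar R}.

Definition cintegral (f : complexBorel R -> R[i]) : R[i] :=
  (\int[mu]_z ReC (f z)) +i* (\int[mu]_z ImC (f z)).

(* Elements of L2(mu) are given by representatives; L2dot does not depend on
   their choice. *)
Definition L2 : set (complexBorel R -> R[i]) :=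
  [set f | @measurable_fun _ _ (complexBorel R) (complexBorel R) setT f /\
           (\int[mu]_z ((normc (f z)) ^+ 2)%:E < +oo)%E].

Definition L2dot (f g : complexBorel R -> R[i]) : R[i] :=
  cintegral (fun z => f z * Num.conj (g z)).

Definition bessel_in_L2 (e : nat -> complexBorel R -> R[i]) (C : R) :=
  is_bessel_sequence L2 L2dot e C.

End complex_integral.

Definition monomial {R : realType} (k : nat) (z : complexBorel R) : R[i] :=
  (z : R[i]) ^+ k.

Record projection_valued_measure (R : realType) (H : hilbertType R) := {
  pvm :> set (complexBorel R) -> {linear H -> H};
  pvm_proj : forall D, measurable D -> is_orthogonal_projection (pvm D);
  pvm0 : forall y, pvm set0 y = 0;
  pvmT : forall y, pvm setT y = y;
  pvmI : forall D1 D2, measurable D1 -> measurable D2 ->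
    forall y, pvm (D1 `&` D2) y = pvm D1 (pvm D2 y);
  pvm_sigma_additive : forall F : nat -> set (complexBorel R),
    (forall k, measurable (F k)) -> trivIset setT F ->
    forall y, (\sum_(0 <= k < n) pvm (F k) y) @[n --> \oo]
                --> pvm (\bigcup_k F k) y
}.

Lemma hdot_real (R : realType) (H : hilbertType R) (y : H) :
  '[y, y] = (ReC '[y, y])%:C.
Proof.
have : 0 <= '[y, y] by rewrite -hdot_norm exprn_ge0.
by case: '[y, y] => a b; rewrite lecE /= => /andP[/eqP -> _].
Qed.

Lemma cvg_ReC (R : realType) (u : nat -> R[i]) (l : R[i]) :
  u n @[n --> \oo] --> (l : (R[i] : numFieldType)) ->
  ReC (u n) @[n --> \oo] --> ReC l.
Proof.
move=> /(@cvgrPdist_lt _ (R[i] : numFieldType)^o) ul; apply/cvgrPdist_lt => e e0.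
have e0C : 0 < e%:C by rewrite ltcR.
apply: filterS (ul _ e0C) => n; rewrite -(ltcR _ e).
by apply: le_lt_trans; rewrite -raddfB normc_ge_Re.
Qed.

Section pvm_measure.
Context {R : realType} {H : hilbertType R}.
Variables (E : projection_valued_measure H) (x : H).

(* The square norm is used rather than '[E D x, x] because a measure has to be
   nonnegative on all sets; see pvm_measureE. *)
Definition pvm_measure (D : set (complexBorel R)) : \bar R :=
  (ReC '[E D x, E D x])%:E.

Lemma pvm_measureE D : measurable D ->
  '[E D x, x] = (fine (pvm_measure D))%:C.
Proof.
move=> mD; have [idem adj] := pvm_proj E mD.
by rewrite -[in LHS]idem adj hdot_real.
Qed.

Let pvm_measure0 : pvm_measure set0 = 0%E.
Proof. by rewrite /pvm_measure pvm0 -hdot_norm normr0 expr0n. Qed.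

Let pvm_measure_ge0 D : (0 <= pvm_measure D)%E.
Proof.
rewrite lee_fin; have : 0 <= '[E D x, E D x] by rewrite -hdot_norm exprn_ge0.
by rewrite lecE => /andP[].
Qed.

Let pvm_orthogonal D1 D2 : measurable D1 -> measurable D2 ->
  D1 `&` D2 = set0 -> '[E D1 x, E D2 x] = 0.
Proof.
move=> m1 m2 d12; have [_ adj] := pvm_proj E m2.
by rewrite -adj -pvmI// setIC d12 pvm0 linear0l.
Qed.

Let pvm_pythagoras F n : (forall k, measurable (F k)) -> trivIset setT F ->
  (\sum_(0 <= k < n) pvm_measure (F k))%E =
  (ReC (`|\sum_(0 <= k < n) E (F k) x| ^+ 2))%:E.
Proof.
move=> mF tF; elim: n => [|n IH].
  by rewrite !big_geq// normr0 expr0n.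
rewrite !big_nat_recr//= {}IH !hdot_norm /pvm_measure -EFinD; congr (_%:E).
rewrite -raddfD -hnormDd// linear_sumlz big_nat big1// => k /andP[_ kn].
apply: pvm_orthogonal => //; apply/eqP/negPn/negP => /set0P kn0.
by move: kn; rewrite (tF _ _ I I kn0) ltnn.
Qed.

Let pvm_measure_sigma_additive : semi_sigma_additive pvm_measure.
Proof.
move=> F mF tF mUF; under eq_fun do rewrite pvm_pythagoras//.
rewrite /pvm_measure -hdot_norm; apply: cvg_EFin; first exact: nearW.
rewrite /comp /=; apply: cvg_ReC; have := @pvm_sigma_additive _ _ E F mF tF x.
by move=> /cvg_norm nE; rewrite expr2; under eq_fun do rewrite expr2; exact: cvgM.
Qed.

HB.instance Definition _ := isMeasure.Build _ (complexBorel R) R pvm_measure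
  pvm_measure0 pvm_measure_ge0 pvm_measure_sigma_additive.

End pvm_measure.

(* A = \int z dE(z), in the weak sense: by polarization the operator A is
   determined by its quadratic form.  As E is supported in a disc, the
   integrand is bounded almost everywhere. *)
Definition is_spectral_measure (R : realType) (H : hilbertType R)
    (A : {linear H -> H}) (E : projection_valued_measure H) :=
  (exists r : R, forall y,
     E [set z : complexBorel R | r < normc (z : R[i])] y = 0) /\
  forall y, '[A y, y] = cintegral (pvm_measure E y) (fun z => z : R[i]).

(* Main.v *)
(* Expanding squares shows that (y_k) is a Bessel sequence with bound C iff
   |sum_k c_k y_k|^2 <= C sum_k |c_k|^2 for all finite families (c_k), so the
   Bessel property only depends on the numbers |sum_k c_k y_k|^2. For A and A*
   these agree up to conjugating the c_k because A is normal. For (i) and (iii)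
   one needs |p(A)x|^2 = \int |p|^2 dmu_x for every polynomial p.

   Let D be a small Borel set around c. As mu_(a+b) = mu_a + mu_b for a in
   ran E(D) and b in ker E(D), the operator A commutes with E(D); on ran E(D)
   the quadratic form of A - c is small, hence by polarization A is close to c
   there and p(A) is close to p(c). Therefore
   G(D) = |E(D)p(A)x|^2 - \int_D |p|^2 dmu_x, which is additive in D, satisfies
   |G(D)| <= K e mu_x(D) whenever D has diameter at most e. Repeated bisection
   carries this estimate over to the disc supporting E, and letting e tend to 0
   gives G = 0. *)

Require Import Defs.
From HB Require Import structures.
From mathcomp Require Import all_boot all_order all_algebra.
From mathcomp Require Import sesquilinear.
From mathcomp Require Import complex.
From mathcomp Require Import all_classical all_reals all_analysis.
From mathcomp Require Import measurable_realfun.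
From mathcomp Require Import ring lra.

Import Order.TTheory GRing.Theory Num.Theory.
Import numFieldNormedType.Exports.

Local Open Scope classical_set_scope.
Local Open Scope ring_scope.
Import ComplexField.Normc.

(** * Bessel sequences and finite linear combinations *)

Section Bessel.
Set Implicit Arguments.
Unset Strict Implicit.
Local Open Scope complex_scope.
Context {R : realType}.

Lemma sqr_normcE (z : R[i]) : normc z ^+ 2 = ReC z ^+ 2 + ImC z ^+ 2.
Proof. by case: z => a b; rewrite sqr_sqrtr// addr_ge0// sqr_ge0. Qed.

Lemma normc_ge0 (z : R[i]) : 0 <= normc z.
Proof. by case: z => a b; exact: sqrtr_ge0. Qed.

Lemma mul_conjc (z : R[i]) : z * Num.conj z = (normc z ^+ 2)%:C.
Proof. by rewrite -normCK rmorphXn. Qed.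

Lemma normc_conj (z : R[i]) : normc (Num.conj z) = normc z.
Proof. by case: z => a b /=; rewrite sqrrN. Qed.

(** Common ground for [H] and L2. Elements of L2 are functions rather than classes, so only
    semidefiniteness is asked; the laws are confined to [S] because the integral is additive only on
    integrable functions. *)
Record semi_inner_product (V : lmodType R[i]) (S : set V)
    (ip : V -> V -> R[i]) : Prop := SemiInnerProduct {
  sip0 : S 0;
  sip_lin : forall a u v, S u -> S v -> S (a *: u + v);
  sip_linl : forall a u v w, S u -> S v -> S w ->
    ip (a *: u + v) w = a * ip u w + ip v w;
  sipC : forall u v, S u -> S v -> ip u v = Num.conj (ip v u);
  sip_ge0 : forall u, S u -> 0 <= ReC (ip u u) }.

Section synthesis.
Context {V : lmodType R[i]} {S : set V} {ip : V -> V -> R[i]}.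
Hypothesis sip : semi_inner_product S ip.

Lemma sip_sum (c : nat -> R[i]) (y : nat -> V) N : (forall k, S (y k)) ->
  S (\sum_(k < N) c k *: y k).
Proof.
move=> Sy; elim: N => [|N IH]; first by rewrite big_ord0; exact: (sip0 sip).
by rewrite big_ord_recr /= addrC; exact: (sip_lin sip).
Qed.

Lemma sip_suml (c : nat -> R[i]) (y : nat -> V) N w :
  (forall k, S (y k)) -> S w ->
  ip (\sum_(k < N) c k *: y k) w = \sum_(k < N) c k * ip (y k) w.
Proof.
move=> Sy Sw; elim: N => [|N IH].
  rewrite !big_ord0; have := sip_linl sip 1 (sip0 sip) (sip0 sip) Sw.
  by rewrite scaler0 addr0 mul1r => /(congr1 (fun t => t - ip 0 w));
    rewrite addrK subrr.
rewrite !big_ord_recr /= addrC (sip_linl sip)//; last exact: sip_sum.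
by rewrite IH addrC.
Qed.

(** This is [ip (v - t u) (v - t u)] expanded for real [t]; the value [t = 1 / C] completes the
    square in the converse below. *)
Lemma sipB_ge0 (t : R) u v : S u -> S v ->
  0 <= ReC (ip v v) - 2 * t * ReC (ip u v) + t ^+ 2 * ReC (ip u u).
Proof.
move=> Su Sv; have S1 : S ((- t%:C) *: u + v) by exact: (sip_lin sip).
have := sip_ge0 sip S1.
rewrite (sip_linl sip)// [ip u _](sipC sip)// [ip v (_ + _)](sipC sip)//.
rewrite !(sip_linl sip)// [ip v u](sipC sip)//.
have := sipC sip Su Su.
case: (ip u u) => a b; case: (ip v v) => a' b'; case: (ip u v) => p q /=.
by move=> _; congr (0 <= _); ring.
Qed.

(* The Bessel inequality for S0 is tested inside the larger space S because L2
   is not obviously closed under subtraction, see componentwise_L2. *)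
Lemma bessel_synthesisP (S0 : set V) (y : nat -> V) (C : R) :
  S0 `<=` S -> (forall N (c : nat -> R[i]), S0 (\sum_(k < N) c k *: y k)) ->
  0 < C -> (forall k, S0 (y k)) ->
  is_bessel_sequence S0 ip y C <->
  forall N (c : nat -> R[i]),
    ReC (ip (\sum_(k < N) c k *: y k) (\sum_(k < N) c k *: y k)) <=
    C * \sum_(k < N) normc (c k) ^+ 2.
Proof.
move=> S0S S0y C0 Sy0; have Sy k : S (y k) by exact: S0S.
split=> [[_ B] N c|B].
  set g := \sum_(k < N) _; have Sg : S g by exact: sip_sum.
  have Bg : \sum_(k < N) normc (ip g (y k)) ^+ 2 <= C * ReC (ip g g).
    rewrite -lee_fin; apply: le_trans (B g (S0y N c)).
    rewrite -sumEFin -(big_mkord xpredT (fun k =>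
      (normc (ip g (y k)) ^+ 2)%:E)).
    by apply: nneseries_lim_ge => k _ _; rewrite lee_fin sqr_ge0.
  (* [sum_k c_k <y_k, g> = <g, g>], so the following gives
     [0 <= C|g|^2 - 2C|g|^2 + C^2 sum_k |c_k|^2] *)
  have : 0 <= \sum_(k < N) normc (ip g (y k) - C%:C * c k) ^+ 2.
    by apply: sumr_ge0 => k _; rewrite sqr_ge0.
  under eq_bigr => k _.
    rewrite (_ : _ ^+ 2 = normc (ip g (y k)) ^+ 2 +
      (- 2 * C * ReC (c k * ip (y k) g) + C ^+ 2 * normc (c k) ^+ 2));
        last first.
      rewrite [ip (y k) g](sipC sip)// !sqr_normcE.
      by case: (ip g (y k)) => p q; case: (c k) => a b /=; ring.
    over.
  rewrite !big_split /= -!mulr_sumr -raddf_sum /= -sip_suml// -/g => h.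
  rewrite -(ler_pM2l C0); nra.
split=> // v /S0S Sv; apply: lime_le.
  by apply: is_cvg_nneseries => k _ _; rewrite lee_fin sqr_ge0.
near=> N; rewrite big_mkord sumEFin lee_fin.
(* with [c_k = <v, y_k>] one has [<g, v> = sum_k |c_k|^2], and the claim is
   [0 <= |v - g / C|^2] *)
pose c k := ip v (y k); have Sg : S (\sum_(k < N) c k *: y k) by exact: sip_sum.
have := B N c; have := sipB_ge0 C^-1 Sg Sv; set g := \sum_(k < N) _ in Sg *.
have -> : ip g v = (\sum_(k < N) normc (c k) ^+ 2)%:C.
  rewrite sip_suml// rmorph_sum; apply: eq_bigr => k _.
  by rewrite (sipC sip)// mul_conjc.
rewrite /=; set s := \sum_(k < N) _; set W := ReC _; set G := ReC _ => h1 h2.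
have : 0 <= C ^+ 2 * (W - 2 * C^-1 * s + C^-1 ^+ 2 * G).
  exact: mulr_ge0 (sqr_ge0 _) h1.
have -> : C ^+ 2 * (W - 2 * C^-1 * s + C^-1 ^+ 2 * G) =
  C ^+ 2 * W - 2 * C * s + G.
  by field; rewrite gt_eqF.
move=> h3; rewrite -(ler_pM2l C0); nra.
Unshelve. all: by end_near. Qed.

End synthesis.
End Bessel.

(** * Hilbert space operators *)

Section hilbert.
Set Implicit Arguments.
Unset Strict Implicit.
Local Open Scope complex_scope.
Context {R : realType}.

(** Norms of modules over [R[i]] take values in [R[i]]; the real value is accessible to ordered
    arithmetic over [R]. *)
Definition rnorm {V : normedModType R[i]} (v : V) : R := ReC `|v|.

Section rnorm.
Context {V : normedModType R[i]}.
Implicit Types u v : V.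

Lemma norm_rnorm v : `|v| = (rnorm v)%:C.
Proof. by rewrite /rnorm RRe_real// ger0_real. Qed.

Lemma rnorm_ge0 v : 0 <= rnorm v.
Proof. by rewrite -lecR -norm_rnorm; exact: normr_ge0. Qed.

Lemma rnormD u v : rnorm (u + v) <= rnorm u + rnorm v.
Proof. by have := ler_normD u v; rewrite !norm_rnorm -rmorphD lecR. Qed.

Lemma rnormZ (a : R[i]) v : rnorm (a *: v) = normc a * rnorm v.
Proof. by rewrite [LHS]/rnorm normrZ norm_rnorm /= mul0r subr0. Qed.

Lemma rnormN v : rnorm (- v) = rnorm v.
Proof. by rewrite /rnorm normrN. Qed.

Lemma rnorm_dist u v : `|rnorm u - rnorm v| <= rnorm (u - v).
Proof.
have := rnormD (u - v) v; have := rnormD (v - u) u.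
by rewrite !subrK -(rnormN (v - u)) opprB ler_norml => *; lra.
Qed.

End rnorm.

Context {H : hilbertType R}.

Lemma hdotDl (u v w : H) : '[u + v, w] = '[u, w] + '[v, w].
Proof. exact: linearDl. Qed.

Lemma hdotDr (u v w : H) : '[w, u + v] = '[w, u] + '[w, v].
Proof. exact: linearDr. Qed.

Lemma hdotBl (u v w : H) : '[u - v, w] = '[u, w] - '[v, w].
Proof. exact: linearBl. Qed.

Lemma hdotBr (u v w : H) : '[w, u - v] = '[w, u] - '[w, v].
Proof. exact: linearBr. Qed.

Lemma hdotZl a (u v : H) : '[a *: u, v] = a * '[u, v].
Proof. exact: linearZl_LR. Qed.

Lemma hdotZr a (u v : H) : '[u, a *: v] = Num.conj a * '[u, v].
Proof. exact: linearZr_LR. Qed.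

Lemma hdotC (u v : H) : '[u, v] = Num.conj '[v, u].
Proof. by rewrite hermC expr0 mul1r. Qed.

Lemma rnorm_hdot (y : H) : '[y, y] = (rnorm y ^+ 2)%:C.
Proof. by rewrite -hdot_norm norm_rnorm rmorphXn. Qed.

Lemma rnorm_sqr (y : H) : ReC '[y, y] = rnorm y ^+ 2.
Proof. by rewrite rnorm_hdot. Qed.

Lemma hdot_sip : semi_inner_product [set: H] (fun u v => '[u, v]).
Proof.
split=> // [a u v w _ _ _|u v _ _|u _].
- by rewrite hdotDl hdotZl.
- exact: hdotC.
- by rewrite rnorm_hdot sqr_ge0.
Qed.

Lemma hdot_sum (c : nat -> R[i]) (y : nat -> H) N :
  '[\sum_(k < N) c k *: y k, \sum_(k < N) c k *: y k] =
  \sum_(j < N) \sum_(k < N) c j * Num.conj (c k) * '[y j, y k].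
Proof.
rewrite (sip_suml hdot_sip)//; apply: eq_bigr => j _.
rewrite hdotC (sip_suml hdot_sip)// rmorph_sum mulr_sumr.
by apply: eq_bigr => k _; rewrite [in RHS]hdotC rmorphM mulrA.
Qed.

Lemma bessel_hdotP (y : nat -> H) C : 0 < C ->
  bessel_in y C <-> forall N (c : nat -> R[i]),
    rnorm (\sum_(k < N) c k *: y k) ^+ 2 <= C * \sum_(k < N) normc (c k) ^+ 2.
Proof.
move=> C0; rewrite /bessel_in (bessel_synthesisP hdot_sip)//.
by split=> h N c; have := h N c; rewrite rnorm_sqr.
Qed.

Lemma parallelogram (u v : H) :
  rnorm (u + v) ^+ 2 + rnorm (u - v) ^+ 2 = 2 * (rnorm u ^+ 2 + rnorm v ^+ 2).
Proof.
rewrite -!rnorm_sqr -scaleN1r !(hdotDl, hdotDr, hdotZl, hdotZr).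
case: '[u, u] => ? ?; case: '[u, v] => ? ?; case: '[v, u] => ? ?.
by case: '[v, v] => ? ? /=; ring.
Qed.

(** Polarization inside the invariant subspace [W], then testing against a multiple of [B u]. The
    two components are bounded separately because complex integrals are estimated componentwise. *)
Lemma quadratic_form_bound (B : {linear H -> H}) (W : H -> Prop) (e : R) :
  0 < e ->
  (forall a u v, W u -> W v -> W (u + a *: v)) ->
  (forall u, W u -> W (B u)) ->
  (forall u, W u -> `|ReC '[B u, u]| <= e * rnorm u ^+ 2 /\
                    `|ImC '[B u, u]| <= e * rnorm u ^+ 2) ->
  forall u, W u -> rnorm (B u) <= 2 * e * rnorm u.
Proof.
move=> e0 WD WB Wq u Wu.
have q a w : '[B (u + a *: w), u + a *: w] =
   '[B u, u] + Num.conj a * '[B u, w] + a * '[B w, u] +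
     a * Num.conj a * '[B w, w].
  by rewrite (linearD B) (linearZ_LR B) !(hdotDl, hdotDr, hdotZl, hdotZr); ring.
(* Real parts of the form at [u + w] and [u - w] bound [Re <Bu, w> + Re <Bw, u>]; imaginary parts at
   [u + iw] and [u - iw] bound the difference of these two terms. *)
have pol w : W w -> ReC '[B u, w] <= e * (rnorm u ^+ 2 + rnorm w ^+ 2).
  move=> Ww.
  have [+ _] := Wq _ (WD 1 _ _ Wu Ww); have [+ _] := Wq _ (WD (-1) _ _ Wu Ww).
  have [_ +] := Wq _ (WD 'i%C _ _ Wu Ww).
  have [_ +] := Wq _ (WD (- 'i%C) _ _ Wu Ww).
  have := parallelogram u ('i%C *: w); have := parallelogram u w.
  rewrite rnormZ !q !scaleNr !scale1r.
  have -> : normc ('i%C : R[i]) = 1 by rewrite /= expr0n expr1n add0r sqrtr1.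
  case: '[B u, u] => ? ?; case: '[B u, w] => ? ?; case: '[B w, u] => ? ?.
  case: '[B w, w] => ? ? /=; rewrite !ler_norml => *; nra.
have W0 : W 0 by have := WD (-1) _ _ Wu Wu; rewrite scaleN1r subrr.
(* Testing with [w = Bu / (2e)] yields [|Bu|^2 / (2e) <= e |u|^2 + |Bu|^2 / (4e)], whence the factor
   2 in the claim. *)
have Ww : W ((2 * e)^-1%:C *: B u).
  by have := WD (2 * e)^-1%:C _ _ W0 (WB _ Wu); rewrite add0r.
have t0 : 0 < (2 * e)^-1 by rewrite invr_gt0 mulr_gt0.
have := pol _ Ww; rewrite rnormZ hdotZr rnorm_hdot /= expr0n addr0 sqrtr_sqr
  gtr0_norm//.
rewrite oppr0 !mul0r subr0 => h.
have {h} : 4 * e * ((2 * e)^-1 * rnorm (B u) ^+ 2) <=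
  4 * e * (e * (rnorm u ^+ 2 + ((2 * e)^-1 * rnorm (B u)) ^+ 2)).
  by rewrite ler_pM2l// mulr_gt0.
have -> : 4 * e * ((2 * e)^-1 * rnorm (B u) ^+ 2) = 2 * rnorm (B u) ^+ 2.
  by field; rewrite gt_eqF.
have -> : 4 * e * (e * (rnorm u ^+ 2 + ((2 * e)^-1 * rnorm (B u)) ^+ 2)) =
  (2 * e * rnorm u) ^+ 2 + rnorm (B u) ^+ 2 by field; rewrite gt_eqF.
move=> h; rewrite -ler_sqr ?nnegrE ?rnorm_ge0//; last first.
  by rewrite !mulr_ge0 ?rnorm_ge0// ltW.
lra.
Qed.

Section normal.
Variables (A B : {linear H -> H}).
Hypothesis adjAB : is_adjoint A B.
Hypothesis normalA : forall y, A (B y) = B (A y).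

Lemma adjoint_iter k y z : '[iter k A y, z] = '[y, iter k B z].
Proof. by elim: k z => // k IH z; rewrite iterS adjAB IH -iterSr. Qed.

(** Normality lets powers of [A] pass powers of [B]: [<B^j x, B^k x> = <A^k B^j x, x> = <B^j A^k x,
    x> = <A^k x, A^j x>]. *)
Lemma normal_gram j k x :
  '[iter j B x, iter k B x] = Num.conj '[iter j A x, iter k A x].
Proof.
have AB1 y : iter k A (B y) = B (iter k A y).
  by elim: k => // n IH; rewrite !iterS IH normalA.
have AB y : iter k A (iter j B y) = iter j B (iter k A y).
  by elim: j => // n IH; rewrite !iterS AB1 IH.
by rewrite -hdotC -adjoint_iter AB hdotC -adjoint_iter -hdotC.
Qed.

Lemma bessel_adjoint x C : 0 < C ->
  bessel_in (fun k => iter k A x) C <-> bessel_in (fun k => iter k B x) C.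
Proof.
move=> C0; rewrite !bessel_hdotP//.
(* The two Gram matrices are conjugate; after exchanging the summation indices, the conjugation
   moves to the coefficients. *)
have gram N (c : nat -> R[i]) : rnorm (\sum_(k < N) c k *: iter k B x) ^+ 2 =
  rnorm (\sum_(k < N) Num.conj (c k) *: iter k A x) ^+ 2.
  rewrite -!rnorm_sqr; congr ReC.
  rewrite (hdot_sum c (fun k => iter k B x)).
  rewrite (hdot_sum (fun k => Num.conj (c k)) (fun k =>
    iter k A x)) exchange_big /=.
  apply: eq_bigr => j _; apply: eq_bigr => k _.
  by rewrite normal_gram -hdotC conjCK [c k * _]mulrC.
split=> h N c.
- rewrite (gram N c); have := h N (fun k => Num.conj (c k)).
  by under [X in _ <= C * X]eq_bigr => k _ do rewrite normc_conj.
- have := h N (fun k => Num.conj (c k));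
  rewrite (gram N (fun k => Num.conj (c k))).
  under [X in rnorm X]eq_bigr => k _ do rewrite conjCK.
  by under [X in _ <= C * X]eq_bigr => k _ do rewrite normc_conj.
Qed.
End normal.
End hilbert.

(** * Borel functions on the complex plane *)

Section complexBorel.
Set Implicit Arguments.
Unset Strict Implicit.
Local Open Scope complex_scope.
Context {R : realType}.

Lemma continuous_complexBorel
    (f : (R[i] : numFieldType) -> (R[i] : numFieldType)) : continuous f ->
  @measurable_fun _ _ (complexBorel R) (complexBorel R) setT f.
Proof.
move=> /continuousP cf; apply: (@measurability _ _ (complexBorel R)
  (complexBorel R) _ _ open) => //.
by move=> _ [B oB <-]; rewrite setTI; apply: sub_sigma_algebra; exact: cf.
Qed.

(** Lipschitz functions are continuous, so open intervals pull back to open sets, which generate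
    [complexBorel]. *)
Lemma normc_lipschitz_measurable (f : complexBorel R -> R) :
  (forall z w : R[i], `|f z - f w| <= normc (z - w)) -> measurable_fun setT f.
Proof.
move=> fL; apply: (measurability _ (RGenOpens.measurableE R)).
move=> _ [_ [a [b ->] <-]]; rewrite setTI; apply: sub_sigma_algebra.
suff /continuousP cf : continuous (f : (R[i] : numFieldType) -> R)
  by exact/cf/interval_open.
move=> z.
apply/(@cvgrPdist_lt _ _ _ _ (nbhs_filter (z : (R[i] : numFieldType)))) => e e0.
have e0C : 0 < e%:C by rewrite ltcR.
apply/nbhs_ballP; exists e%:C => //= w; rewrite -ball_normE /= norm_rnorm ltcR.
exact: le_lt_trans.
Qed.

Lemma normc_ge_absRe (z : R[i]) : `|ReC z| <= normc z.
Proof. by rewrite -lecR; exact: normc_ge_Re. Qed.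

Lemma normc_ge_absIm (z : R[i]) : `|ImC z| <= normc z.
Proof.
case: z => a b; rewrite -sqrtr_sqr ler_wsqrtr//=.
by rewrite lerDr sqr_ge0.
Qed.

Lemma normc_le_ReIm (z : R[i]) : normc z <= `|ReC z| + `|ImC z|.
Proof.
rewrite -ler_sqr ?nnegrE ?addr_ge0 ?normc_ge0//.
rewrite sqr_normcE sqrrD !real_normK ?num_real// lerD2r lerDl.
by rewrite mulrn_wge0// mulr_ge0.
Qed.

Lemma ReC_measurable : measurable_fun setT (fun z : complexBorel R => ReC z).
Proof. by apply: normc_lipschitz_measurable => z w;
  rewrite -raddfB normc_ge_absRe. Qed.

Lemma ImC_measurable : measurable_fun setT (fun z : complexBorel R => ImC z).
Proof. by apply: normc_lipschitz_measurable => z w;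
  rewrite -raddfB normc_ge_absIm. Qed.

Lemma normc_measurable : measurable_fun setT (fun z : complexBorel R =>
  normc (z : R[i])).
Proof. by apply: normc_lipschitz_measurable => z w;
  exact: (@rnorm_dist _ R[i]^o). Qed.

Lemma measurable_lt_cst (f : complexBorel R -> R) (t : R) :
  measurable_fun setT f -> measurable [set z | f z < t].
Proof.
move=> mf; have := mf measurableT _ (measurable_itv `]-oo, t[).
by rewrite setTI; congr measurable; apply/seteqP; split => z; rewrite /= in_itv.
Qed.

Lemma polynomial_continuous (K : numFieldType) N (c : nat -> K) :
  continuous (fun z : K => \sum_(k < N) c k * z ^+ k).
Proof.
have cX k : continuous (fun z : K => z ^+ k).
  move=> z; elim: k => [|n /(continuousM cvg_id) ih];
    first exact: cst_continuous.
  by rewrite /continuous_at exprS; under eq_fun do rewrite exprS; exact: ih.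
elim: N => [|N IH] z.
  rewrite (_ : (fun _ => _) = fun=> 0); first exact: cst_continuous.
  by apply/funext => w; rewrite big_ord0.
rewrite (_ : (fun _ => _) = (fun z : K => \sum_(k < N) c k * z ^+ k) +
  (fun=> c N) \* (fun z : K => z ^+ N)); last first.
  by apply/funext => w; rewrite big_ord_recr.
by apply: continuousD (IH z) _; apply: continuousM (cX N z);
  exact: cst_continuous.
Qed.

Lemma polynomial_measurable N (c : nat -> R[i]) :
  @measurable_fun _ _ (complexBorel R) (complexBorel R) setT
    (fun z => \sum_(k < N) c k * (z : R[i]) ^+ k).
Proof. by apply: continuous_complexBorel; exact: polynomial_continuous. Qed.
End complexBorel.

(** * Local estimates and bisection *)

Section bisection.
Set Implicit Arguments.
Unset Strict Implicit.
Local Open Scope complex_scope.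
Context {R : realType}.

(** A polynomial is a length and a coefficient sequence, as in the synthesis inequality; shifting
    the sequence gives Horner's recursion. [T] is a bare function so that multiplication by a number
    is also allowed. *)
Definition poly_op {V : lmodType R[i]} (T : V -> V) N
    (c : nat -> R[i]) (v : V) : V :=
  \sum_(k < N) c k *: iter k T v.

Lemma poly_opS (V : lmodType R[i]) (T : {linear V -> V}) N c v :
  poly_op T N.+1 c v = c 0%N *: v + T (poly_op T N (fun k => c k.+1) v).
Proof.
rewrite /poly_op big_ord_recl; congr (_ + _); rewrite linear_sum.
by apply: eq_bigr => k _; rewrite linearZ.
Qed.

Definition poly_val N (c : nat -> R[i]) (z : R[i]) := \sum_(k < N) c k * z ^+ k.

Lemma poly_valS N c z :
  poly_val N.+1 c z = c 0%N + z * poly_val N (fun k => c k.+1) z.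
Proof.
rewrite /poly_val big_ord_recl expr0 mulr1; congr (_ + _); rewrite mulr_sumr.
by apply: eq_bigr => k _; rewrite exprS mulrCA.
Qed.

(** Makes estimates on [poly_op] available for polynomial functions, by acting on the
    one-dimensional space [R[i]]. *)
Lemma poly_val_op N c z :
  poly_val N c z = poly_op (fun w => z * w : R[i]^o) N c 1.
Proof.
apply: eq_bigr => k _; congr (_ * _); elim: (k : nat) => // n IH.
by rewrite iterS -IH exprS.
Qed.

Lemma poly_val_bound N c M : 0 <= M ->
  exists2 B, 0 <= B & forall z, normc z <= M -> normc (poly_val N c z) <= B.
Proof.
move=> M0; elim: N c => [|N IH] c.
  by exists 0 => // z _; rewrite /poly_val big_ord0 normc0.
have [B B0 h] := IH (fun k => c k.+1).
exists (normc (c 0%N) + M * B) => [|z zM].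
  by rewrite addr_ge0 ?mulr_ge0//; exact: normc_ge0.
rewrite poly_valS (le_trans (le_normcD _ _))// lerD2l normcM.
by apply: ler_pM => //; [exact: normc_ge0..|exact: h].
Qed.

Definition near_scalar {V : normedModType R[i]} (T : V -> V) (W : V -> Prop)
    (z : R[i]) (e : R) :=
  forall v, W v -> rnorm (T v - z *: v) <= e * rnorm v.

(** Induction by Horner's scheme. The cap on [e] keeps [K] independent of [e]; it is 2 because
    operators will be [2 * e]-close to a scalar with [e <= 1]. *)
Lemma near_scalar_poly N c M : 0 <= M -> exists2 K, 0 <= K &
  forall (V : normedModType R[i]) (T : {linear V -> V}) (W : V -> Prop) z e,
    0 <= e <= 2 -> normc z <= M ->
    (forall a u v, W u -> W v -> W (u + a *: v)) ->
    (forall u, W u -> W (T u)) ->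
    near_scalar T W z e ->
    near_scalar (poly_op T N c) W (poly_val N c z) (K * e).
Proof.
move=> M0; elim: N c => [|N IH] c.
  exists 0 => // V T W z e _ _ _ _ _ v _.
  by rewrite /poly_op /poly_val !big_ord0 scale0r subrr mul0r /rnorm normr0
    mul0r.
have [K K0 h] := IH (fun k => c k.+1).
have [B B0 hB] := poly_val_bound N (fun k => c k.+1) M0.
(* The first term bounds [T w] for the error [w] of the shifted polynomial, as
   [|T w| <= (e + M) |w|]; [B] bounds the value of that polynomial at [z]. *)
exists ((2 + M) * K + B) => [|V T W z e /andP[e0 e1] zM WD WT Tz v Wv].
  by rewrite addr_ge0 ?mulr_ge0 ?addr_ge0.
have Wp n a : W (poly_op T n a v).
  rewrite /poly_op; elim: n => [|n IHn].
    by rewrite big_ord0; have := WD (-1) _ _ Wv Wv; rewrite scaleN1r subrr.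
  by rewrite big_ord_recr; apply: WD => //; elim: n {IHn} => //= n; exact: WT.
rewrite poly_opS poly_valS; set p := poly_val _ _ _.
pose w := poly_op T N (fun k => c k.+1) v - p *: v.
have Ww : W w by rewrite /w -scaleNr; exact: WD.
have -> : c 0%N *: v + T (poly_op T N (fun k => c k.+1) v)
    - (c 0%N + z * p) *: v = (T w - z *: w) + z *: w + p *: (T v - z *: v).
  rewrite subrK /w (linearB T) (linearZ_LR T) /= scalerBr scalerA [p * z]mulrC
    addrA.
  by rewrite subrK scalerDl opprD addrACA subrr add0r.
have hw : rnorm w <= K * e * rnorm v by apply: (h V T W z e) => //; apply/andP.
have h1 := Tz _ Ww; have h2 := Tz _ Wv.
apply: (le_trans (rnormD _ _)).
have : rnorm (p *: (T v - z *: v)) <= B * (e * rnorm v).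
  by rewrite rnormZ ler_pM ?rnorm_ge0//; [exact: normc_ge0|exact: hB].
have : rnorm (z *: w) <= M * rnorm w by rewrite rnormZ ler_wpM2r ?rnorm_ge0.
have := rnormD (T w - z *: w) (z *: w).
have : e * rnorm w <= 2 * rnorm w by rewrite ler_wpM2r ?rnorm_ge0.
have : (2 + M) * rnorm w <= (2 + M) * (K * e * rnorm v)
  by rewrite ler_wpM2l ?addr_ge0.
lra.
Qed.

(* K does not depend on V: the estimate is applied both to an operator on H and
   to multiplication by a number on R[i]. *)
Lemma near_scalar_sqr N c M : 0 <= M -> exists2 K, 0 <= K &
  forall (V : normedModType R[i]) (T : {linear V -> V}) (W : V -> Prop) z e,
    0 <= e <= 2 -> normc z <= M ->
    (forall a u v, W u -> W v -> W (u + a *: v)) ->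
    (forall u, W u -> W (T u)) ->
    near_scalar T W z e -> forall v, W v ->
    `|rnorm (poly_op T N c v) ^+ 2 - normc (poly_val N c z) ^+ 2 * rnorm v ^+ 2|
      <= K * e * rnorm v ^+ 2.
Proof.
move=> M0; have [K K0 hK] := near_scalar_poly N c M0.
have [B B0 hB] := poly_val_bound N c M0.
(* From [|s^2 - t^2| = |s - t| |s + t|] with [|s - t| <= K e r], [t <= B r] and [e <= 2]. *)
exists (K * (2 * B + 2 * K)) => [|V T W z e /andP[e0 e1] zM WD WT Tz v Wv].
  by rewrite mulr_ge0// addr_ge0 ?mulr_ge0.
have ee : 0 <= e <= 2 by rewrite e0.
have := hK _ _ _ _ _ ee zM WD WT Tz _ Wv; set p := poly_val _ _ _.
set a := poly_op _ _ _ _ => h1.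
have := le_trans (rnorm_dist _ _) h1; rewrite rnormZ -exprMn.
have : normc p * rnorm v <= B * rnorm v by rewrite ler_wpM2r ?rnorm_ge0// hB.
have : K * e * rnorm v <= K * 2 * rnorm v
  by rewrite ler_wpM2r ?rnorm_ge0// ler_wpM2l.
have : 0 <= normc p * rnorm v.
  by rewrite mulr_ge0 ?rnorm_ge0//; exact: normc_ge0.
have := rnorm_ge0 a; have := rnorm_ge0 v.
set s := rnorm a; set t := normc p * rnorm v; set r := rnorm v =>
  r0 s0 t0 h2 h3 h4.
rewrite subr_sqr normrM.
have : `|s + t| <= (2 * B + 2 * K) * r.
  by rewrite ger0_norm ?addr_ge0//; move: h4; rewrite ler_norml => /andP[? ?];
    lra.
move=> h5; apply: le_trans (ler_pM _ _ h4 h5) _ => //.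
by rewrite le_eqVlt; apply/orP; left; apply/eqP; ring.
Qed.

(** Since [m] is additive along with [G], the bound for a fixed [e] survives gluing with the same
    constant, and only then does [e] tend to 0. *)
Lemma bisection (S : set (complexBorel R))
    (G m : set (complexBorel R) -> R) (r K : R) :
  measurable S -> (forall z : R[i], S z -> normc z <= r) -> 0 <= K ->
  (forall D P, measurable D -> measurable P ->
    G D = G (D `&` P) + G (D `&` ~` P)) ->
  (forall D P, measurable D -> measurable P ->
    m D = m (D `&` P) + m (D `&` ~` P)) ->
  (forall e D, 0 < e -> e <= 1 -> measurable D -> D `<=` S ->
     (forall z w : R[i], D z -> D w -> normc (z - w) <= e) ->
     `|G D| <= K * e * m D) ->
  G S = 0.
Proof.
move=> mS Sr K0 GD mD small.
have main e : 0 < e -> e <= 1 -> `|G S| <= K * e * m S.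
  move=> e0 e1; set d := e / 2; have d0 : 0 < d by rewrite divr_gt0.
  (* The smallest boxes have side [e / 2], so that [|Re| + |Im|] keeps their diameter within [e]. *)
  pose box n k (a b : R) : set (complexBorel R) :=
    [set z | a <= ReC z < a + 2 ^+ n * d /\ b <= ImC z < b + 2 ^+ k * d].
  have split D P : measurable D -> measurable P ->
    `|G (D `&` P)| <= K * e * m (D `&` P) ->
    `|G (D `&` ~` P)| <= K * e * m (D `&` ~` P) -> `|G D| <= K * e * m D.
    move=> mD' mP h1 h2; rewrite (GD D P)// (mD D P)// mulrDr.
    by rewrite (le_trans (ler_normD _ _))// lerD.
  have mltRe t : measurable [set z : complexBorel R | ReC z < t].
    exact: measurable_lt_cst ReC_measurable.
  have mltIm t : measurable [set z : complexBorel R | ImC z < t].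
    exact: measurable_lt_cst ImC_measurable.
  (* The width is halved until [n] reaches 0, then the height. *)
  have bisect n k a b D : measurable D -> D `<=` S -> D `<=` box n k a b ->
      `|G D| <= K * e * m D.
    elim: n a b D => [a b|n IHn a b D].
      elim: k b => [b|k IHk b] D mD' DS Db.
        apply: small => // z w /Db[/andP[? ?] /andP[? ?]] /Db[/andP[? ?]
          /andP[? ?]].
        apply: le_trans (normc_le_ReIm _) _; rewrite !raddfB /=.
        have : `|ReC z - ReC w| <= d by rewrite ler_norml; lra.
        have : `|ImC z - ImC w| <= d by rewrite ler_norml; lra.
        by rewrite /d; lra.
      apply: (split D [set z | ImC z < b + 2 ^+ k * d]) => //.
        apply: (IHk b) => [||z [/Db[za /andP[zb _]] zt]];
          first exact: measurableI.
          by move=> z [/DS].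
        by split=> //; rewrite zb.
      apply: (IHk (b + 2 ^+ k * d)) => [||z [/Db[za /andP[zb zb']] /negP zt]].
      - by apply: measurableI => //; exact: measurableC.
      - by move=> z [/DS].
      - split=> //; rewrite leNgt zt /=; move: zb'; rewrite exprS; lra.
    move=> mD' DS Db.
    apply: (split D [set z | ReC z < a + 2 ^+ n * d]) => //.
      apply: (IHn a b) => [||z [/Db[/andP[zb _] za] zt]];
        first exact: measurableI.
        by move=> z [/DS].
      by split=> //; rewrite zb.
    apply: (IHn (a + 2 ^+ n * d) b) => [||z [/Db[/andP[zb zb'] za] /negP zt]].
    - by apply: measurableI => //; exact: measurableC.
    - by move=> z [/DS].
    - split=> //; rewrite leNgt zt /=; move: zb'; rewrite exprS; lra.
  (* The box must cover the square from [- r] to [r]; the extra 1 accounts for its open upper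
     edges. *)
  have [n rn] : exists n, 2 * r + 1 <= 2 ^+ n * d.
    exists (Num.bound ((2 * r + 1) / d)); rewrite -ler_pdivrMr// ltW//.
    exact: upper_nthrootP.
  apply: (bisect n n (- r) (- r)) => // z /Sr zr; split.
    by have := le_trans (normc_ge_absRe _) zr; rewrite ler_norml => /andP[? ?];
      lra.
  by have := le_trans (normc_ge_absIm _) zr; rewrite ler_norml => /andP[? ?];
    lra.
apply/eqP; rewrite -normr_le0; apply/ler_addgt0Pl => e e0.
rewrite addr0.
(* The case [e = 1] shows [0 <= K * m S], so the denominator chosen next is positive. *)
have mS0 := le_trans (normr_ge0 _) (main 1 ltr01 (lexx _)).
pose d := Num.min 1 (e / (K * m S + 1)).
have k0 : 0 < K * m S + 1 by rewrite mulr1 in mS0; lra.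
have d0 : 0 < d by rewrite lt_min ltr01 divr_gt0.
have d1 : d <= 1 by rewrite ge_min lexx.
apply: le_trans (main _ d0 d1) _; rewrite mulr1 in mS0.
have : d * (K * m S + 1) <= e by rewrite -ler_pdivlMr// ge_min lexx orbT.
by lra.
Qed.
End bisection.

(** * Spectral measures *)

Section spectral.
Set Implicit Arguments.
Unset Strict Implicit.
Local Open Scope complex_scope.
Context {R : realType} {H : hilbertType R}.

(** Comparison with the constants [a - e] and [a + e]. Integrability is included because the case
    [a = 0] supplies it for functions bounded on the disc. *)
Lemma Rintegral_near_cst (mu : {measure set (complexBorel R) -> \bar R})
    D (f : complexBorel R -> R) (a e : R) :
  measurable D -> (mu D < +oo)%E -> measurable_fun setT f ->
  (forall z, D z -> `|f z - a| <= e) ->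
  mu.-integrable D (EFin \o f) /\
  `|\int[mu]_(z in D) f z - a * fine (mu D)| <= e * fine (mu D).
Proof.
move=> mD muD mf fa.
have int_f : mu.-integrable D (EFin \o f).
  apply: measurable_bounded_integrable => //; first exact: measurable_funTS.
  exists (`|a| + e); split; first exact: num_real.
  move=> M aM z /= /fa fz.
  apply: le_trans (ltW aM); rewrite -[f z](subrK a).
  by rewrite (le_trans (ler_normD _ _))// addrC lerD2l.
have int_cst t : mu.-integrable D (EFin \o (fun=> t)).
  apply: measurable_bounded_integrable => //.
  exact: bounded_cst.
split=> //.
have h1 : \int[mu]_(z in D) (a - e) <= \int[mu]_(z in D) f z.
  apply: le_Rintegral => // z /fa; rewrite ler_norml => /andP[? ?]; lra.
have h2 : \int[mu]_(z in D) f z <= \int[mu]_(z in D) (a + e).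
  apply: le_Rintegral => // z /fa; rewrite ler_norml => /andP[? ?]; lra.
move: h1 h2; rewrite !Rintegral_cst// => h1 h2.
by rewrite ler_norml; lra.
Qed.

Variable E : projection_valued_measure H.

Lemma pvm_measure_rnorm y D : pvm_measure E y D = (rnorm (E D y) ^+ 2)%:E.
Proof. by rewrite /pvm_measure rnorm_sqr. Qed.

Lemma pvm_measure_null y D : E D y = 0 -> pvm_measure E y D = 0%E.
Proof. by rewrite pvm_measure_rnorm => ->; rewrite /rnorm normr0 expr0n. Qed.

Lemma pvm_measure_lty y D : (pvm_measure E y D < +oo)%E.
Proof. exact: ltry. Qed.

Lemma pvm_idem D y : measurable D -> E D (E D y) = E D y.
Proof. by move=> /(pvm_proj E)[]. Qed.

Lemma pvm_selfadjoint D y z : measurable D -> '[E D y, z] = '[y, E D z].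
Proof. by move=> /(pvm_proj E)[_]; apply. Qed.

Lemma pvm_comm D1 D2 y : measurable D1 -> measurable D2 ->
  E D1 (E D2 y) = E D2 (E D1 y).
Proof. by move=> m1 m2; rewrite -!pvmI// setIC. Qed.

Lemma pvm_setC D y : measurable D -> E D y = y -> E (~` D) y = 0.
Proof.
move=> mD <-; rewrite -pvmI//; last exact: measurableC.
by rewrite setICl pvm0.
Qed.

Lemma pvm_measure_split w D P : measurable D -> measurable P ->
  rnorm (E D w) ^+ 2 =
  rnorm (E (D `&` P) w) ^+ 2 + rnorm (E (D `&` ~` P) w) ^+ 2.
Proof.
move=> mD mP; apply: EFin_inj; rewrite EFinD -!pvm_measure_rnorm.
rewrite -measureU//.
- by rewrite -setIUr setUCr setIT.
- exact: measurableI.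
- by apply: measurableI => //; exact: measurableC.
- by rewrite setIACA setICr setI0.
Qed.

(** As [E P] commutes with [E D], the vectors [E P a] and [E P b] stay in the range and the kernel
    of [E D], hence are orthogonal. *)
Lemma pvm_measureD D a b : measurable D -> E D a = a -> E D b = 0 ->
  forall P, measurable P ->
  pvm_measure E (a + b) P = (pvm_measure E a P + pvm_measure E b P)%E.
Proof.
move=> mD Da Db P mP; rewrite !pvm_measure_rnorm -EFinD; congr EFin.
rewrite (linearD (E P)); apply: complexI.
have ab : '[E P a, E P b] = 0.
  by rewrite -Da pvm_comm// pvm_selfadjoint// pvm_comm// Db !linear0.
rewrite -!rnorm_sqr !(hdotDl, hdotDr) ab [in '[E P b, E P a]]hdotC ab.
by rewrite conjC0 addr0 add0r raddfD.
Qed.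

Variables (r : R).
Hypothesis E_out : forall y,
  E [set z : complexBorel R | r < normc (z : R[i])] y = 0.

Definition disc : set (complexBorel R) := [set z | normc (z : R[i]) <= r].

Lemma discCE : ~` disc = [set z : complexBorel R | r < normc (z : R[i])].
Proof. by apply/seteqP; split => z /=; rewrite ltNge => /negP. Qed.

Lemma measurable_disc : measurable disc.
Proof.
rewrite -[disc]setCK discCE; apply: measurableC.
have mN : measurable_fun setT (fun z : complexBorel R => - normc (z : R[i])).
  by apply: measurableT_comp => //; exact: normc_measurable.
have := measurable_lt_cst (- r) mN.
by congr measurable; apply/seteqP; split => z /=; rewrite ltrN2.
Qed.

(** The vector [y - E disc y] is annihilated by [E disc] and by [E] of the complement, so its
    squared norm splits into two zeros. *)
Lemma pvm_disc y : E disc y = y.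
Proof.
have := pvm_measure_split (y - E disc y) measurableT measurable_disc.
rewrite !setTI pvmT discCE E_out linearB pvm_idem ?subrr//;
  last exact: measurable_disc.
by rewrite {2 3}/rnorm normr0 expr0n addr0 => /eqP; rewrite sqrf_eq0 => /eqP h;
  apply/esym/eqP; rewrite -subr_eq0 -normr_eq0 norm_rnorm h.
Qed.

(** A bound on the disc suffices, its complement being a null set. *)
Lemma integrable_pvm y (f : complexBorel R -> R) M : measurable_fun setT f ->
  (forall z, disc z -> `|f z| <= M) ->
  (pvm_measure E y).-integrable setT (EFin \o f).
Proof.
move=> mf fM; have mdisc := measurable_disc.
apply/(@negligible_integrable _ _ _ _ _ (~` disc)) => //.
- exact: measurableC.
- exact/measurable_EFinP.
- by apply: pvm_measure_null; rewrite discCE E_out.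
rewrite setTD setCK; have [] // :=
  @Rintegral_near_cst (pvm_measure E y) disc f 0 M.
  exact: pvm_measure_lty.
by move=> z /fM; rewrite subr0.
Qed.

(** For [y] in the range of [E D], the measure of [y] is concentrated on [D]. *)
Lemma Rintegral_pvm_null y (f : complexBorel R -> R) M D :
  measurable_fun setT f ->
  (forall z, disc z -> `|f z| <= M) -> measurable D -> E D y = y ->
  \int[pvm_measure E y]_z f z = \int[pvm_measure E y]_(z in D) f z.
Proof.
move=> mf fM mD Dy; rewrite /Rintegral (@negligible_integral _ _ _ _ _ (~` D))
  //.
- by rewrite setTD setCK.
- exact: measurableC.
- exact: integrable_pvm fM.
- by apply: pvm_measure_null; exact: pvm_setC.
Qed.

Lemma Rintegral_pvmD D a b (f : complexBorel R -> R) M :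
  measurable_fun setT f ->
  (forall z, disc z -> `|f z| <= M) -> measurable D -> E D a = a -> E D b = 0 ->
  \int[pvm_measure E (a + b)]_z f z =
  \int[pvm_measure E a]_z f z + \int[pvm_measure E b]_z f z.
Proof.
move=> mf fM mD Da Db.
have ia := @integrable_pvm a f M mf fM; have ib := @integrable_pvm b f M mf fM.
rewrite /Rintegral -fineD ?integrable_fin_num//; congr fine.
rewrite -(integral_measure_add measurableT ia ib).
apply: eq_measure_integral => P mP _.
exact: etrans (pvm_measureD mD Da Db mP) (esym (measure_addE _ _ _)).
Qed.

Lemma sqr_poly_measurable N c :
  measurable_fun setT (fun z : complexBorel R => normc (poly_val N c z) ^+ 2).
Proof.
apply: measurable_funX; apply: (measurableT_comp normc_measurable).
exact: polynomial_measurable.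
Qed.

(** The radius may be negative, with an empty disc, while the polynomial bounds ask for a
    nonnegative radius. *)
Lemma disc_normr (z : R[i]) : disc z -> normc z <= `|r|.
Proof. by move=> /le_trans; apply; exact: ler_norm. Qed.

Lemma sqr_poly_bounded N c :
  exists M, forall z, disc z -> `|normc (poly_val N c z) ^+ 2| <= M.
Proof.
have [B B0 hB] := poly_val_bound N c (normr_ge0 r).
exists (B ^+ 2) => z /disc_normr /hB h.
by rewrite ger0_norm ?sqr_ge0// ler_sqr// nnegrE normc_ge0.
Qed.

Variable A : {linear H -> H}.
Hypothesis A_spectral :
  forall y, '[A y, y] = cintegral (pvm_measure E y) (fun z => z : R[i]).

Let Re_disc z : disc z -> `|ReC z| <= r.
Proof. exact/le_trans/normc_ge_absRe. Qed.

Let Im_disc z : disc z -> `|ImC z| <= r.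
Proof. exact/le_trans/normc_ge_absIm. Qed.

(* The quadratic form of A is additive on a + b, so <Aa, b> + <Ab, a> = 0;
   replacing a by ia kills both terms. *)
Lemma pvm_reduces D a b : measurable D -> E D a = a -> E D b = 0 ->
  '[A a, b] = 0 /\ '[A b, a] = 0.
Proof.
move=> mD Da Db.
have q u v : E D u = u -> E D v = 0 -> '[A u, v] + '[A v, u] = 0.
  move=> Du Dv; have := A_spectral (u + v);
    rewrite (linearD A) !(hdotDl, hdotDr).
  rewrite !A_spectral /cintegral !(Rintegral_pvmD ReC_measurable Re_disc mD Du
    Dv).
  rewrite !(Rintegral_pvmD ImC_measurable Im_disc mD Du Dv).
  set p := '[A u, v]; set p' := '[A v, u].
  case: p => ? ?; case: p' => ? ? [? ?]; congr (_ +i* _); lra.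
have h1 := q _ _ Da Db.
have iDa : E D ('i%C *: a) = 'i%C *: a by rewrite linearZ /= Da.
have := q _ _ iDa Db; rewrite (linearZ_LR A) hdotZl hdotZr.
move: h1; case: '[A a, b] => ? ?; case: '[A b, a] => ? ? [? ?] [? ?].
by split; congr (_ +i* _); lra.
Qed.

(** With [a = E D y] and [b = y - a], the commutator applied to [y] is
    [w = (A a - E D (A a)) - E D (A b)]. Self-adjointness turns [<w, w>] into
    [<A a, w - E D w> - <A b, E D w>], and [pvm_reduces] kills both terms. *)
Lemma pvm_commute D y : measurable D -> A (E D y) = E D (A y).
Proof.
move=> mD; apply/eqP; rewrite -subr_eq0 -normr_eq0 -sqrf_eq0 hdot_norm.
have hy : y = E D y + (y - E D y) by rewrite addrC subrK.
have Da : E D (E D y) = E D y by exact: pvm_idem.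
have Db : E D (y - E D y) = 0 by rewrite linearB pvm_idem// subrr.
move: hy Da Db; set a := E D y; set b := y - a => -> Da Db.
have -> : A a - E D (A (a + b)) = (A a - E D (A a)) - E D (A b).
  by rewrite (linearD A) (linearD (E D)) opprD addrA.
set w := _ - E D (A b).
have Dw : E D (w - E D w) = 0 by rewrite linearB pvm_idem// subrr.
have -> : '[w, w] = '[A a, w - E D w] - '[A b, E D w].
  by rewrite [in RHS]hdotBr {1}/w !hdotBl !pvm_selfadjoint.
have [-> _] := pvm_reduces mD Da Dw.
by have [_ ->] := pvm_reduces mD (pvm_idem w mD) Db; rewrite subrr.
Qed.

Lemma pvm_range_linear D a (u v : H) :
  E D u = u -> E D v = v -> E D (u + a *: v) = u + a *: v.
Proof. by move=> Du Dv; rewrite (linearD (E D)) (linearZ_LR (E D)) /= Du Dv.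
Qed.

Lemma pvm_range_stable D u : measurable D -> E D u = u -> E D (A u) = A u.
Proof. by move=> mD Du; rewrite -pvm_commute// Du. Qed.

(** On the range of [E D] the form of [A - c] is the integral of [z - c] over [D], with both
    components at most [e |u|^2]; the factor 2 comes from [quadratic_form_bound]. *)
Lemma pvm_near_scalar (D : set (complexBorel R)) (c : R[i]) (e : R) :
  measurable D -> 0 < e ->
  (forall z : R[i], D z -> normc (z - c) <= e) ->
  near_scalar A (fun y => E D y = y) c (2 * e).
Proof.
move=> mD e0 Dc.
pose B := (A \- c \*: @idfun H) : {linear H -> H}.
apply: (@quadratic_form_bound _ _ B (fun y => E D y = y) e e0) =>
  [a u v|u Du|u Du].
- exact: pvm_range_linear.
- by rewrite (linearB (E D)) (linearZ_LR (E D)) /= pvm_range_stable// Du.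
have -> : '[B u, u] = '[A u, u] - c * '[u, u].
  by rewrite /= hdotBl hdotZl.
have uD : rnorm u ^+ 2 = fine (pvm_measure E u D)
  by rewrite pvm_measure_rnorm Du.
have dRe (z : R[i]) : D z -> `|ReC z - ReC c| <= e.
  by move=> /Dc; rewrite -raddfB; exact/le_trans/normc_ge_absRe.
have [_ hRe] := Rintegral_near_cst mD (pvm_measure_lty u D) ReC_measurable dRe.
have dIm (z : R[i]) : D z -> `|ImC z - ImC c| <= e.
  by move=> /Dc; rewrite -raddfB; exact/le_trans/normc_ge_absIm.
have [_ hIm] := Rintegral_near_cst mD (pvm_measure_lty u D) ImC_measurable dIm.
rewrite A_spectral rnorm_hdot /cintegral.
rewrite (Rintegral_pvm_null ReC_measurable Re_disc mD Du).
rewrite (Rintegral_pvm_null ImC_measurable Im_disc mD Du) uD.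
move: hRe hIm; case: c {B Dc dRe dIm} => p q /=.
by rewrite !mulr0 subr0 add0r.
Qed.

Lemma pvm_poly_op D N c y : measurable D ->
  E D (poly_op A N c y) = poly_op A N c (E D y).
Proof.
move=> mD; rewrite /poly_op linear_sum; apply: eq_bigr => k _.
rewrite linearZ /=; congr (_ *: _); elim: (k : nat) => // n IH.
by rewrite !iterS -IH pvm_commute.
Qed.

Lemma poly_op_norm N c x :
  rnorm (poly_op A N c x) ^+ 2 =
    \int[pvm_measure E x]_z normc (poly_val N c z) ^+ 2.
Proof.
set w := poly_op A N c x; pose f (z : complexBorel R) :=
  normc (poly_val N c z) ^+ 2.
have mf : measurable_fun setT f by exact: sqr_poly_measurable.
have [B fB] := sqr_poly_bounded N c.
have [K K0 hK] := near_scalar_sqr N c (normr_ge0 r).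
pose G D := rnorm (E D w) ^+ 2 - \int[pvm_measure E x]_(z in D) f z.
have int_f D : measurable D -> (pvm_measure E x).-integrable D (EFin \o f).
  by move=> mD; apply: integrableS (integrable_pvm x mf fB) => //.
(* This is the claim, as [E disc] is the identity and the measure of [x] lives on the disc. *)
suff : G disc = 0.
  rewrite /G pvm_disc => /subr0_eq ->.
  by rewrite (Rintegral_pvm_null mf fB measurable_disc (pvm_disc x)).
(* Of the constant [3 * K], a share [2 * K] comes from [A] being [2 * e]-close to a scalar on the
   range of [E D], and [K] from the oscillation of [f] on [D]. *)
apply: (@bisection _ disc G (fun D => rnorm (E D x) ^+ 2) r (3 * K)) => //.
- exact: measurable_disc.
- by rewrite mulr_ge0.
- move=> D P mD mP; rewrite /G (pvm_measure_split w mD mP).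
  have mDP : measurable (D `&` P) by exact: measurableI.
  have mDCP : measurable (D `&` ~` P) by apply: measurableI => //;
    exact: measurableC.
  have DE : (D `&` P) `|` (D `&` ~` P) = D by rewrite -setIUr setUCr setIT.
  rewrite -[in X in _ - X]DE Rintegral_setU ?DE//; first lra;
    first exact: int_f.
  by apply/disj_setPS; rewrite setIACA setICr setI0.
- by move=> D P mD mP; exact: pvm_measure_split.
move=> e D e0 e1 mD Dd diam.
have [D0|/eqP/set0P[a Da]] := pselect (D = set0).
  by rewrite /G D0 !pvm0 Rintegral_set0 subr0 /rnorm normr0 expr0n normr0 mulr0.
have Da' (z : R[i]) : D z -> normc (z - a) <= e by move=> Dz; exact: diam.
have uD : rnorm (E D x) ^+ 2 = fine (pvm_measure E x D)
  by rewrite pvm_measure_rnorm.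
have ee : 0 <= 2 * e <= 2 by apply/andP; split; lra.
have ee' : 0 <= e <= 2 by apply/andP; split; lra.
have ar := disc_normr (Dd _ Da).
have := hK H A (fun y => E D y = y) a (2 * e) ee ar (@pvm_range_linear D)
  (fun u => pvm_range_stable mD) (pvm_near_scalar mD e0 Da') _ (pvm_idem x mD).
rewrite -pvm_poly_op// -/w => h1.
have hf z : D z -> `|f z - f a| <= K * e.
  move=> Dz.
  (* The same estimate for multiplication by [z] on [R[i]], which is [e]-close to multiplication by
     [a], applied to the vector 1. *)
  have := hK R[i]^o ((z : R[i]) \*: @idfun R[i]^o) (fun=> True) a e ee' ar.
  move=> /(_ _ _ _ 1 I).
  have rnormC (t : R[i]) : @rnorm _ R[i]^o t = normc t by [].
  rewrite -poly_val_op !rnormC normc1 expr1n !mulr1; apply => //.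
  by move=> v _; rewrite -scalerBl rnormZ ler_wpM2r ?rnorm_ge0// Da'.
have [_] := Rintegral_near_cst mD (pvm_measure_lty x D) mf hf.
rewrite -uD; move: h1; rewrite /G /f !ler_norml; lra.
Qed.

End spectral.

(** * The semi-inner product of L2 *)

Section L2.
Set Implicit Arguments.
Unset Strict Implicit.
Local Open Scope complex_scope.
Context {R : realType}.
Variable mu : {measure set (complexBorel R) -> \bar R}.

Local Notation func := (complexBorel R -> R[i]^o).

(* Measurability of both components is stable under sums at once, whereas for
   Borel functions into C this requires the second countability of C. *)
Definition componentwise_L2 : set func :=
  [set f : func |
    [/\ measurable_fun setT (fun z : complexBorel R => ReC (f z : R[i])),
        measurable_fun setT (fun z : complexBorel R => ImC (f z : R[i])) &
        mu.-integrable setT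
          (EFin \o (fun z : complexBorel R => normc (f z : R[i]) ^+ 2))]].

Lemma measurable_sqr_normc (f : func) :
  measurable_fun setT (fun z : complexBorel R => ReC (f z : R[i])) ->
  measurable_fun setT (fun z : complexBorel R => ImC (f z : R[i])) ->
  measurable_fun setT (fun z : complexBorel R => normc (f z : R[i]) ^+ 2).
Proof.
move=> mr mi; under eq_fun do rewrite sqr_normcE.
by apply: measurable_funD; exact: measurable_funX.
Qed.

Lemma L2_componentwise : L2 mu `<=` componentwise_L2.
Proof.
move=> f [mf foo]; have {}foo :
  (\int[mu]_z (normc (f z) ^+ 2)%:E < +oo)%E by [].
have mr : measurable_fun setT (fun z : complexBorel R => ReC (f z : R[i])).
  exact: (measurableT_comp ReC_measurable mf).
have mi : measurable_fun setT (fun z : complexBorel R => ImC (f z : R[i])).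
  exact: (measurableT_comp ImC_measurable mf).
split => //; apply/integrableP; split.
  by apply/measurable_EFinP; exact: measurable_sqr_normc.
by under eq_integral do rewrite /= ger0_norm ?sqr_ge0//.
Qed.

Let comb_val a (f g : func) (z : complexBorel R) :
  (a *: f + g) z = a * (f z : R[i]) + g z :> R[i].
Proof. by []. Qed.

(** Dominated through [|p + q|^2 <= 2 |p|^2 + 2 |q|^2]. *)
Lemma componentwise_L2_lin a (f g : func) :
  componentwise_L2 f -> componentwise_L2 g -> componentwise_L2 (a *: f + g).
Proof.
move=> [mfr mfi fi] [mgr mgi gi].
have mr : measurable_fun setT (fun z : complexBorel R =>
  ReC ((a *: f + g) z : R[i])).
  rewrite (_ : (fun _ => _) = fun z => ReC a * ReC (f z) - ImC a * ImC (f z) +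
    ReC (g z)).
    apply: measurable_funD => //; apply: measurable_funB;
      apply: measurable_funM => //.
  by apply/funext => z; rewrite comb_val; case: (a) => ? ?; case: (f z);
    case: (g z).
have mi : measurable_fun setT (fun z : complexBorel R =>
  ImC ((a *: f + g) z : R[i])).
  rewrite (_ : (fun _ => _) = fun z => ReC a * ImC (f z) + ImC a * ReC (f z) +
    ImC (g z)).
    apply: measurable_funD => //; apply: measurable_funD;
      apply: measurable_funM => //.
  by apply/funext => z; rewrite comb_val; case: (a) => ? ?; case: (f z);
    case: (g z).
split => //.
apply: (@le_integrable _ _ _ mu _ measurableT _ (EFin \o
  (fun z : complexBorel R =>
   2 * normc a ^+ 2 * normc (f z) ^+ 2 + 2 * normc (g z) ^+ 2))).
- by apply/measurable_EFinP; exact: measurable_sqr_normc.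
- move=> z _ /=; rewrite lee_fin !ger0_norm ?sqr_ge0 ?addr_ge0 ?mulr_ge0
  ?normc_ge0//.
  rewrite -mulrA -exprMn -normcM.
  rewrite comb_val !sqr_normcE /=; set t := a * _.
  case: t => p q; case: (g z) => p' q' /=.
  by have := sqr_ge0 (p - p'); have := sqr_ge0 (q - q'); nra.
- exact: (integrableD measurableT (integrableZl measurableT (2 * normc a ^+ 2)
  fi)
                                  (integrableZl measurableT 2 gi)).
Qed.

(** Both components of the product are dominated by [|f|^2 + |g|^2]. *)
Lemma dot_integrable (f g : func) : componentwise_L2 f -> componentwise_L2 g ->
  mu.-integrable setT (EFin \o (fun z : complexBorel R =>
    ReC (f z * Num.conj (g z)))) /\
  mu.-integrable setT (EFin \o (fun z : complexBorel R =>
    ImC (f z * Num.conj (g z)))).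
Proof.
move=> [mfr mfi fi] [mgr mgi gi].
have bound := integrableD measurableT fi gi.
have eRe z : ReC (f z * Num.conj (g z)) = ReC (f z) * ReC (g z) +
  ImC (f z) * ImC (g z).
  by case: (f z) => ? ?; case: (g z) => ? ? /=; ring.
have eIm z : ImC (f z * Num.conj (g z)) =
  ImC (f z) * ReC (g z) - ReC (f z) * ImC (g z).
  by case: (f z) => ? ?; case: (g z) => ? ? /=; ring.
split; apply: (le_integrable measurableT _ _ bound).
- apply/measurable_EFinP; under eq_fun do rewrite eRe.
  by apply: measurable_funD; exact: measurable_funM.
- move=> z _; rewrite /= lee_fin [leRHS]ger0_norm ?addr_ge0 ?sqr_ge0//.
  rewrite eRe !sqr_normcE ler_norml; case: (f z) => p q; case: (g z) =>
    p' q' /=.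
  have := sqr_ge0 (p + p'); have := sqr_ge0 (p - p').
  by have := sqr_ge0 (q + q'); have := sqr_ge0 (q - q'); nra.
- apply/measurable_EFinP; under eq_fun do rewrite eIm.
  by apply: measurable_funB; exact: measurable_funM.
- move=> z _; rewrite /= lee_fin [leRHS]ger0_norm ?addr_ge0 ?sqr_ge0//.
  rewrite eIm !sqr_normcE ler_norml; case: (f z) => p q; case: (g z) =>
    p' q' /=.
  have := sqr_ge0 (q + p'); have := sqr_ge0 (q - p').
  by have := sqr_ge0 (p + q'); have := sqr_ge0 (p - q'); nra.
Qed.

Lemma L2dot_sip : semi_inner_product componentwise_L2
  (L2dot mu : func -> func -> R[i]).
Proof.
split=> [|a f g|a f g h Sf Sg Sh|f g Sf Sg|f Sf].
- split; [exact: measurable_cst..|].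
  by under eq_fun do rewrite normc0 expr0n; exact: integrable0.
- exact: componentwise_L2_lin.
- have [fr fi] := dot_integrable Sf Sh; have [gr gi] := dot_integrable Sg Sh.
  rewrite /L2dot /cintegral.
  (* Each component of the integrand is a real combination of integrable components, which puts
     linearity of the real integral within reach. *)
  rewrite (_ : (fun z => ReC _) = fun z =>
    (ReC a * ReC (f z * Num.conj (h z)) +
      - ImC a * ImC (f z * Num.conj (h z))) +
    ReC (g z * Num.conj (h z))); last first.
    apply/funext => z; rewrite comb_val.
    by case: a => ? ?; case: (f z) => ? ?; case: (g z) => ? ?; case: (h z) =>
      ? ? /=; ring.
  rewrite (_ : (fun z => ImC _) = fun z =>
    (ReC a * ImC (f z * Num.conj (h z)) + ImC a * ReC (f z * Num.conj (h z))) +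
    ImC (g z * Num.conj (h z))); last first.
    apply/funext => z; rewrite comb_val.
    by case: a => ? ?; case: (f z) => ? ?; case: (g z) => ? ?; case: (h z) =>
      ? ? /=; ring.
  have Z t (u : complexBorel R -> R) : mu.-integrable setT (EFin \o u) ->
      mu.-integrable setT (EFin \o (fun z : complexBorel R => t * u z)).
    exact: integrableZl.
  rewrite !RintegralD ?RintegralZl//; try exact: Z.
  + by case: a => p q /=; congr (_ +i* _); ring.
  + exact: (integrableD measurableT (Z _ _ _) (Z _ _ _)).
  + exact: (integrableD measurableT (Z _ _ _) (Z _ _ _)).
- have [fr fi] := dot_integrable Sg Sf.
  rewrite /L2dot /cintegral.
  rewrite (_ : (fun z => ReC _) = fun z => ReC (g z * Num.conj (f z)));
    last first.
    by apply/funext => z; case: (f z) => ? ?; case: (g z) => ? ? /=; ring.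
  rewrite (_ : (fun z => ImC _) = fun z => -1 * ImC (g z * Num.conj (f z)));
    last first.
    by apply/funext => z; case: (f z) => ? ?; case: (g z) => ? ? /=; ring.
  by rewrite RintegralZl// mulN1r.
- by apply: Rintegral_ge0 => z _; rewrite mul_conjc /= sqr_ge0.
Qed.

End L2.

(** * Monomials in L2 and the orbit of x *)

Section main.
Set Implicit Arguments.
Unset Strict Implicit.
Local Open Scope complex_scope.
Context {R : realType} {H : hilbertType R}.
Variables (A : {linear H -> H}) (E : projection_valued_measure H).
Hypothesis AE : is_spectral_measure A E.

Lemma sum_monomial N (c : nat -> R[i]) (z : complexBorel R) :
  (\sum_(k < N) c k *: (monomial k : complexBorel R -> R[i]^o)) z =
  poly_val N c z.
Proof. by rewrite fct_sumE. Qed.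

(** Polynomials are bounded on the disc carrying the finite measure of [x]. *)
Lemma polynomial_L2 x N (c : nat -> R[i]) :
  L2 (pvm_measure E x)
    (\sum_(k < N) c k *: (monomial k : complexBorel R -> R[i]^o)).
Proof.
have [[r Er] _] := AE.
rewrite (_ : \sum_(k < N) _ = poly_val N c); last by apply/funext => z;
  exact: sum_monomial.
split; first exact: polynomial_measurable.
have [M hM] := sqr_poly_bounded r N c.
have /integrableP[_] := integrable_pvm Er x (sqr_poly_measurable N c) hM.
by under eq_integral do rewrite /= ger0_norm ?sqr_ge0//.
Qed.

(** Both properties become synthesis inequalities with the same right-hand side, and [poly_op_norm]
    identifies their left-hand sides. *)
Lemma bessel_monomial x C : 0 < C ->
  bessel_in (fun k => iter k A x) C <->
  bessel_in_L2 (pvm_measure E x) (@monomial R) C.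
Proof.
move=> C0; have [[r Er] Aq] := AE; rewrite bessel_hdotP//.
have L2k k : L2 (pvm_measure E x) (monomial k).
  have := polynomial_L2 x k.+1 (fun j => (j == k)%:R).
  rewrite big_ord_recr /= eqxx scale1r big1 ?add0r// => j _.
  by rewrite ltn_eqF// scale0r.
have := bessel_synthesisP (L2dot_sip (pvm_measure E x)) (@L2_componentwise _ _)
  (polynomial_L2 x) C0 L2k.
have norm N (c : nat -> R[i]) : ReC (L2dot (pvm_measure E x)
    (\sum_(k < N) c k *: (monomial k : complexBorel R -> R[i]^o))
    (\sum_(k < N) c k *: (monomial k : complexBorel R -> R[i]^o))) =
    rnorm (\sum_(k < N) c k *: iter k A x) ^+ 2.
  rewrite (poly_op_norm Er Aq) /L2dot /cintegral /=; congr Rintegral.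
  by apply/funext => z; rewrite !sum_monomial mul_conjc.
move=> [h1 h2]; split=> h.
- by apply: h2 => N c; rewrite norm.
- by move=> N c; rewrite -norm; exact: h1.
Qed.

End main.

Theorem lemma4p1 (R : realType) (H : hilbertType R)
  (A Astar : {linear H -> H}) (E : projection_valued_measure H)
  (x : H) (C : R) :
  is_bounded_operator A ->
  is_adjoint A Astar ->
  (forall y, A (Astar y) = Astar (A y)) ->
  is_spectral_measure A E ->
  0 < C ->
  [<-> bessel_in (fun k => iter k A x) C;
       bessel_in (fun k => iter k Astar x) C;
       bessel_in_L2 (pvm_measure E x) (@monomial R) C].
Proof.
move=> _ adj normal AE C0.
have i_ii := bessel_adjoint adj normal x C0.
have i_iii := bessel_monomial AE x C0.
by tfae; [exact: i_ii.1|move=> /i_ii.2 /i_iii.1|exact: i_iii.2].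
Qed.
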